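(* Assume that for every universe \(\mathcal T\), the type \(\Omega_{\mathcal T}\) has size \(\mathcal U_0\). Let \(X\) be a poset with carrier in a universe \(\mathcal U\). Then the following are equivalent: (i) \(X\) has suprema for all subsets \(S:X\to\Omega_{\mathcal T}\) (for every universe \(\mathcal T\)); (ii) \(X\) has suprema for all \(\mathcal U\)-covered subsets; (iii) \(X\) has suprema for all subsets whose total spaces have size \(\mathcal U\); (iv) \(X\) has suprema for all families \(I\to X\) with \(I:\mathcal U\).
   Context: Setting: intensional Martin-Löf type theory with universes (\(\mathcal U_0\) the lowest universe), function extensionality, propositional extensionality, propositional truncation. \(\Omega_{\mathcal T}\) is the type of propositions in \(\mathcal T\); a type has size \(\mathcal W\) if it is equivalent to a type in \(\mathcal W\). A poset is a type with a proposition-valued reflexive, transitive, antisymmetric relation. A subset of \(X\) is a map \(S:X\to\Omega_{\mathcal T}\) for some universe \(\mathcal T\); a supremum of \(S\) is a least upper bound of \(\{x : S(x)\}\). The total space of \(S\) is \(\mathbb T(S):=\Sigma_{x:X}S(x)\). \(S\) is \(\mathcal U\)-covered if there is a type \(I:\mathcal U\) with a surjection \(I\twoheadrightarrow\mathbb T(S)\). *)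

(* Defs.v *)
(* Identity types are rendered by Corelib's [eq].  It lives in [Prop], but its
   elimination into [Type] is the full J rule and no K/UIP is assumed; whether
   an identity type is small is decided by the codes [c_id] below, not by its
   sort.  All other propositions are types in [Type] with at most one
   element. *)

Definition is_prop (A : Type) : Prop := forall x y : A, x = y.

Definition is_equiv {A B : Type} (f : A -> B) : Type :=
  {g : B -> A | forall b, f (g b) = b} * {h : B -> A | forall a, h (f a) = a}.

Definition equiv (A B : Type) : Type := {f : A -> B & is_equiv f}.

Infix "≃" := equiv (at level 85, no associativity).

Definition iffT (A B : Type) : Type := (A -> B) * (B -> A).

Infix "<=>" := iffT (at level 95, no associativity).

Definition funext : Prop :=
  forall (A : Type) (B : A -> Type) (f g : forall a, B a),
    (forall a, f a = g a) -> f = g.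

Record prop_trunc := {
  trunc : Type -> Type;
  trunc_is_prop : forall A, is_prop (trunc A);
  tr : forall A, A -> trunc A;
  trunc_rec : forall A P, is_prop P -> (A -> P) -> trunc A -> P
}.

(* Rocq's own universe levels can only be quantified at the head of a
   statement, so the universes of the type theory are taken a la Tarski, with
   codes [A : U] decoded to types [El U A].  The decoding laws hold up to
   equivalence only. *)
Record universe (pt : prop_trunc) := {
  code :> Type;
  El : code -> Type;

  c_empty : code;
  c_unit : code;
  c_nat : code;
  c_sum : code -> code -> code;
  c_pi : forall A : code, (El A -> code) -> code;
  c_sigma : forall A : code, (El A -> code) -> code;
  c_id : forall A : code, El A -> El A -> code;
  c_trunc : code -> code;

  El_empty : El c_empty ≃ Empty_set;
  El_unit : El c_unit ≃ unit;
  El_nat : El c_nat ≃ nat;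
  El_sum : forall A B, El (c_sum A B) ≃ El A + El B;
  El_pi : forall A B, El (c_pi A B) ≃ (forall a : El A, El (B a));
  El_sigma : forall A B, El (c_sigma A B) ≃ {a : El A & El (B a)};
  El_id : forall A x y, El (c_id A x y) ≃ (x = y);
  El_trunc : forall A, El (c_trunc A) ≃ trunc pt (El A)
}.

Arguments El {pt} {u} A : rename.

(* The universes are indexed by a type of levels, so that "for every universe"
   is an ordinary quantifier.  Successor and least upper bound of levels are
   not required: a finite chain of Rocq universes [Type@{i}], with [El] the
   identity, is an instance as soon as each of them has truncations. *)
Record hierarchy (pt : prop_trunc) := {
  level : Type;
  univ :> level -> universe pt;
  level_le : level -> level -> Prop;
  level_le_refl : forall T, level_le T T;
  level_le_trans : forall T T' T'',
    level_le T T' -> level_le T' T'' -> level_le T T'';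
  lift : forall T T', level_le T T' -> univ T -> univ T';
  El_lift : forall T T' (le : level_le T T') (A : univ T),
    El (lift T T' le A) ≃ El A;
  level0 : level;
  level0_le : forall T, level_le level0 T
}.

Arguments level {pt} h.
Arguments level0 {pt} h.

Definition propext {pt} (W : universe pt) : Prop :=
  forall P Q : W, is_prop (El P) -> is_prop (El Q) ->
    (El P -> El Q) -> (El Q -> El P) -> P = Q.

Definition has_size {pt} (W : universe pt) (A : Type) : Type :=
  {B : W & El B ≃ A}.

Definition Omega {pt} (T : universe pt) : Type := {P : T | is_prop (El P)}.

Definition holds {pt} {T : universe pt} (P : Omega T) : Type := El (proj1_sig P).

(* [U] is the universe of the carrier, [V] the one of the order relation. *)
Record poset {pt} (U V : universe pt) := {
  carrier : U;
  order : El carrier -> El carrier -> Omega V;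
  order_refl : forall x, holds (order x x);
  order_trans : forall x y z,
    holds (order x y) -> holds (order y z) -> holds (order x z);
  order_antisym : forall x y,
    holds (order x y) -> holds (order y x) -> x = y
}.

Definition point {pt} {U V : universe pt} (X : poset U V) : Type :=
  El (carrier U V X).

Coercion point : poset >-> Sortclass.

Definition le {pt} {U V : universe pt} {X : poset U V} (x y : X) : Type :=
  holds (order U V X x y).

Infix "⊑" := le (at level 70, no associativity).

Definition subset {pt} (T : universe pt) (A : Type) : Type := A -> Omega T.

Definition total_space {pt} {T : universe pt} {A : Type} (S : subset T A) : Type :=
  {x : A & holds (S x)}.

Definition surjective (pt : prop_trunc) {A B : Type} (f : A -> B) : Type :=
  forall b, trunc pt {a : A | f a = b}.

Definition covered {pt} (U : universe pt) {T : universe pt} {A : Type}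
    (S : subset T A) : Type :=
  {I : U & {e : El I -> total_space S & surjective pt e}}.

(* Suprema are unique by antisymmetry, so having one is a proposition and needs
   no truncation. *)
Definition has_sup_subset {pt} {U V : universe pt} (X : poset U V)
    {T : universe pt} (S : subset T X) : Type :=
  {s : X & ((forall x : X, holds (S x) -> x ⊑ s) *
            (forall y : X, (forall x : X, holds (S x) -> x ⊑ y) -> s ⊑ y))%type}.

Definition has_sup_family {pt} {U V : universe pt} (X : poset U V)
    {I : Type} (a : I -> X) : Type :=
  {s : X & ((forall i : I, a i ⊑ s) *
            (forall y : X, (forall i : I, a i ⊑ y) -> s ⊑ y))%type}.

Definition all_subset_sups {pt} (H : hierarchy pt) {U V : level H}
    (X : poset (H U) (H V)) : Type :=
  forall (T : level H) (S : subset (H T) X), has_sup_subset X S.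

Definition covered_subset_sups {pt} (H : hierarchy pt) {U V : level H}
    (X : poset (H U) (H V)) : Type :=
  forall (T : level H) (S : subset (H T) X),
    covered (H U) S -> has_sup_subset X S.

Definition sized_subset_sups {pt} (H : hierarchy pt) {U V : level H}
    (X : poset (H U) (H V)) : Type :=
  forall (T : level H) (S : subset (H T) X),
    has_size (H U) (total_space S) -> has_sup_subset X S.

Definition family_sups {pt} (H : hierarchy pt) {U V : level H}
    (X : poset (H U) (H V)) : Type :=
  forall (I : H U) (a : El I -> X), has_sup_family X a.

(* Main.v *)
(** A surjection onto the total space of a subset has the same upper bounds as
    the subset.  Hence suprema of families give suprema of covered subsets, and
    the supremum of the image of a family is a supremum of the family; the image
    of a family indexed in the universe of the carrier has a total space in that
    universe, which is closed under identity types, truncations and sums.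

    Resizing only enters through the total spaces of arbitrary subsets.  By
    propositional extensionality a proposition [P] of [T] holds iff it equals the
    true proposition.  As [Omega T] is equivalent to a type in the lowest
    universe, this equation has a code in every universe; so every proposition,
    and with it every total space, has a code in the universe of the carrier. *)

From Stdlib Require Import Eqdep_dec.
Require Import Defs.

Definition equiv_fun {A B : Type} (e : A ≃ B) : A -> B := projT1 e.

Coercion equiv_fun : equiv >-> Funclass.

Definition equiv_inv {A B : Type} (e : A ≃ B) : B -> A :=
  proj1_sig (fst (projT2 e)).

Lemma equiv_funK {A B : Type} (e : A ≃ B) (b : B) : e (equiv_inv e b) = b.
Proof. exact (proj2_sig (fst (projT2 e)) b). Qed.

Lemma equiv_invK {A B : Type} (e : A ≃ B) (a : A) : equiv_inv e (e a) = a.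
Proof.
  destruct e as [f [[g fg] [h hf]]]; cbn.
  rewrite <- (hf (g (f a))), fg. apply hf.
Qed.

Lemma equiv_inv_inj {A B : Type} (e : A ≃ B) (b b' : B) :
  equiv_inv e b = equiv_inv e b' -> b = b'.
Proof.
  intros E. rewrite <- (equiv_funK e b), <- (equiv_funK e b'), E. reflexivity.
Qed.

Definition equiv_of_inverses {A B : Type} (f : A -> B) (g : B -> A)
    (fg : forall b, f (g b) = b) (gf : forall a, g (f a) = a) : A ≃ B :=
  existT _ f (exist _ g fg, exist _ g gf).

Definition equiv_refl (A : Type) : A ≃ A :=
  equiv_of_inverses (fun a => a) (fun a => a) (fun _ => eq_refl) (fun _ => eq_refl).

Lemma equiv_trans {A B C : Type} : A ≃ B -> B ≃ C -> A ≃ C.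
Proof.
  intros e e'.
  apply (equiv_of_inverses (fun a => e' (e a))
                           (fun c => equiv_inv e (equiv_inv e' c))).
  - intros c. rewrite !equiv_funK. reflexivity.
  - intros a. rewrite !equiv_invK. reflexivity.
Qed.

Lemma equiv_sigT {A : Type} {B C : A -> Type} :
  (forall a, B a ≃ C a) -> {a : A & B a} ≃ {a : A & C a}.
Proof.
  intros e.
  apply (equiv_of_inverses
           (fun p => existT C (projT1 p) (e _ (projT2 p)))
           (fun p => existT B (projT1 p) (equiv_inv (e _) (projT2 p)))).
  - intros [a c]; cbn. rewrite equiv_funK. reflexivity.
  - intros [a b]; cbn. rewrite equiv_invK. reflexivity.
Qed.

Lemma is_prop_equiv {A B : Type} (e : A ≃ B) : is_prop B -> is_prop A.
Proof.
  intros pB x y. rewrite <- (equiv_invK e x), <- (equiv_invK e y).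
  apply f_equal, pB.
Qed.

Lemma equiv_of_is_prop {A B : Type} :
  is_prop A -> is_prop B -> (A -> B) -> (B -> A) -> A ≃ B.
Proof.
  intros pA pB f g. apply (equiv_of_inverses f g); intros; [apply pB | apply pA].
Qed.

Lemma is_prop_is_prop (fe : funext) (A : Type) : is_prop (is_prop A).
Proof.
  intros p q. apply fe. intros x. apply fe. intros y.
  apply eq_proofs_unicity_on. intros z. left. apply p.
Qed.

Lemma surjective_rec {pt : prop_trunc} {A B : Type} {f : A -> B}
    (f_surj : surjective pt f) (P : B -> Type) :
  (forall b, is_prop (P b)) -> (forall a, P (f a)) -> forall b, P b.
Proof.
  intros P_prop Pf b. apply (trunc_rec pt _ _ (P_prop b)) with (2 := f_surj b).
  intros [a <-]. apply Pf.
Qed.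

Section Size.

Context {pt : prop_trunc} {W : universe pt}.

Lemma has_size_El (A : W) : has_size W (El A).
Proof. exact (existT _ A (equiv_refl _)). Qed.

Lemma has_size_sigT {A : W} (B : El A -> Type) :
  (forall a, has_size W (B a)) -> has_size W {a : El A & B a}.
Proof.
  intros sB. exists (c_sigma pt W A (fun a => projT1 (sB a))).
  apply (equiv_trans (El_sigma _ _ _ _)), equiv_sigT.
  intros a. exact (projT2 (sB a)).
Qed.

Lemma is_prop_El_trunc (A : W) : is_prop (El (c_trunc pt W A)).
Proof. apply (is_prop_equiv (El_trunc pt W A)), trunc_is_prop. Qed.

(* [El A] may have several elements, hence the truncation of [A]. *)
Lemma has_size_of_iff {P : Type} (A : W) :
  is_prop P -> (El A -> P) -> (P -> El A) -> has_size W P.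
Proof.
  intros pP f g. exists (c_trunc pt W A).
  apply equiv_of_is_prop; [apply is_prop_El_trunc | exact pP | |].
  - intros t. exact (trunc_rec pt _ _ pP f (El_trunc pt W A t)).
  - intros p. exact (equiv_inv (El_trunc pt W A) (tr pt _ (g p))).
Qed.

Lemma covered_of_has_size {T : universe pt} {A : Type} (S : subset T A) :
  has_size W (total_space S) -> covered W S.
Proof.
  intros [I e]. exists I, e. intros b. apply tr.
  exists (equiv_inv e b). apply equiv_funK.
Qed.

End Size.

Lemma has_size_lift {pt : prop_trunc} (H : hierarchy pt) {T T' : level H}
    (A : Type) : level_le pt H T T' -> has_size (H T) A -> has_size (H T') A.
Proof.
  intros TT' [B e]. exists (lift pt H T T' TT' B).
  exact (equiv_trans (El_lift pt H T T' TT' B) e).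
Qed.

Section Propositions.

Context {pt : prop_trunc} {T : universe pt}.

Lemma is_prop_holds (P : Omega T) : is_prop (holds P).
Proof. exact (proj2_sig P). Qed.

Lemma is_prop_El_unit : is_prop (El (c_unit pt T)).
Proof. apply (is_prop_equiv (El_unit pt T)). intros [] []. reflexivity. Qed.

Definition truth : Omega T := exist _ (c_unit pt T) is_prop_El_unit.

Lemma holds_truth : holds truth.
Proof. exact (equiv_inv (El_unit pt T) tt). Qed.

Hypothesis fe : funext.
Hypothesis pe : propext T.

Lemma Omega_ext (P Q : Omega T) :
  (holds P -> holds Q) -> (holds Q -> holds P) -> P = Q.
Proof.
  intros PQ QP. apply eq_sig_hprop.
  - intros A. apply (is_prop_is_prop fe).
  - exact (pe _ _ (is_prop_holds P) (is_prop_holds Q) PQ QP).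
Qed.

Lemma has_size_holds {W : universe pt} :
  has_size W (Omega T) -> forall P : Omega T, has_size W (holds P).
Proof.
  intros [B e] P.
  apply (has_size_of_iff (c_id pt W B (equiv_inv e P) (equiv_inv e truth))).
  - apply is_prop_holds.
  - intros d. apply (El_id pt W), equiv_inv_inj in d.
    rewrite d. apply holds_truth.
  - intros p. apply (equiv_inv (El_id pt W _ _ _)), f_equal, Omega_ext.
    + intros _. apply holds_truth.
    + intros _. exact p.
Qed.

End Propositions.

Section Image.

Context {pt : prop_trunc} {U : universe pt} {A I : U} (f : El I -> El A).

Definition image : subset U (El A) :=
  fun x => exist _ (c_trunc pt U (c_sigma pt U I (fun i => c_id pt U A (f i) x)))
                   (is_prop_El_trunc _).

Lemma holds_image (x : El A) : holds (image x) <=> trunc pt {i | f i = x}.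
Proof.
  split; intros h.
  - apply (trunc_rec pt _ _ (trunc_is_prop pt _)) with (2 := El_trunc _ _ _ h).
    intros s. destruct (El_sigma _ _ _ _ s) as [i d].
    apply tr. exists i. exact (El_id _ _ _ _ _ d).
  - apply (trunc_rec pt _ _ (is_prop_holds (image x))) with (2 := h).
    intros [i fi]. apply (equiv_inv (El_trunc _ _ _)), tr.
    apply (equiv_inv (El_sigma _ _ _ _)). exists i.
    exact (equiv_inv (El_id _ _ _ _ _) fi).
Qed.

Lemma has_size_image : has_size U (total_space image).
Proof. apply has_size_sigT. intros x. apply has_size_El. Qed.

Definition corestriction (i : El I) : total_space image :=
  existT _ (f i) (snd (holds_image (f i)) (tr pt _ (exist _ i eq_refl))).

Lemma corestriction_surjective : surjective pt corestriction.
Proof.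
  intros [x h].
  apply (trunc_rec pt _ _ (trunc_is_prop pt _)) with (2 := fst (holds_image x) h).
  intros [i fi]. apply tr. exists i. apply eq_sigT_hprop; [|exact fi].
  intros y. apply is_prop_holds.
Qed.

End Image.

Section Suprema.

Context {pt : prop_trunc} {U V : universe pt} {X : poset U V}.

Lemma is_prop_le (x y : X) : is_prop (x ⊑ y).
Proof. apply is_prop_holds. Qed.

Context {T : universe pt} {S : subset T X} {I : Type} {e : I -> total_space S}.
Hypothesis e_surj : surjective pt e.

Lemma upper_bound_surjective (y : X) :
  (forall x : X, holds (S x) -> x ⊑ y) <=> (forall i, projT1 (e i) ⊑ y).
Proof.
  split.
  - intros ub i. exact (ub _ (projT2 (e i))).
  - intros ub x Sx.
    exact (surjective_rec e_surj (fun p => projT1 p ⊑ y)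
             (fun p => is_prop_le _ y) ub (existT _ x Sx)).
Qed.

Lemma has_sup_surjective :
  has_sup_subset X S <=> has_sup_family X (fun i => projT1 (e i)).
Proof.
  split; intros [s [ub lub]]; exists s; split.
  - exact (fst (upper_bound_surjective s) ub).
  - intros y uby. exact (lub y (snd (upper_bound_surjective y) uby)).
  - exact (snd (upper_bound_surjective s) ub).
  - intros y uby. exact (lub y (fst (upper_bound_surjective y) uby)).
Qed.

End Suprema.

Theorem theorem5p8 (fe : funext) (pt : prop_trunc) (H : hierarchy pt)
    (pe : forall T : level H, propext (H T))
    (resizing : forall T : level H, has_size (H (level0 H)) (Omega (H T)))
    (U V : level H) (X : poset (H U) (H V)) :
  (all_subset_sups H X <=> covered_subset_sups H X) *
  (covered_subset_sups H X <=> sized_subset_sups H X) *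
  (sized_subset_sups H X <=> family_sups H X).
Proof.
  assert (all_covered : all_subset_sups H X -> covered_subset_sups H X)
    by (intros sups T S _; apply sups).
  assert (covered_sized : covered_subset_sups H X -> sized_subset_sups H X)
    by (intros sups T S sS; apply sups, covered_of_has_size, sS).
  assert (sized_family : sized_subset_sups H X -> family_sups H X).
  { intros sups I a.
    apply (has_sup_surjective (corestriction_surjective (A := carrier _ _ X) a)).
    apply sups, has_size_image. }
  assert (family_covered : family_sups H X -> covered_subset_sups H X)
    by (intros sups T S [I [e e_surj]]; apply (has_sup_surjective e_surj), sups).
  assert (sized_all : sized_subset_sups H X -> all_subset_sups H X).
  { intros sups T S. apply sups, has_size_sigT. intros x.
    apply (has_size_holds fe (pe T)), (has_size_lift H _ (level0_le pt H U)).
    apply resizing. }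
  repeat split; auto.
Qed.
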